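(* Let $q$ be a prime power and let $s\ge 2$ be an integer such that $q$ divides $s$. Then there are infinitely many integers $n$ for which there exists a co-edge-regular graph of level at least $3$ that is cospectral with the $s$-clique extension of each Latin Square graph $LS_{q+1}(qn)$, and hence has exactly four distinct eigenvalues.
   Context: All graphs are finite, simple and undirected; eigenvalues and spectrum are those of the adjacency matrix; two graphs are cospectral if they have the same spectrum (with multiplicities). For adjacent vertices $x,y$, $\lambda(x,y)$ denotes the number of common neighbours of $x$ and $y$. A regular graph is co-edge-regular with parameter $\mu$ if any two distinct non-adjacent vertices have exactly $\mu$ common neighbours. A co-edge-regular graph has level $t$ if $\#\{\lambda(x,y)\mid x,y \text{ adjacent}\}=t$. Write $[N]=\{1,\dots,N\}$. An orthogonal array $OA(N,m)$ is an $m\times N^2$ array with entries in $[N]$ such that for any two distinct rows $r_i,r_j$ the pairs $(r_i(\ell),r_j(\ell))$, $\ell=1,\dots,N^2$, take $N^2$ different values. Given an $OA(N,m)$ with columns $c_1,\dots,c_{N^2}$, the associated Latin Square graph $LS_m(N)$ has vertex set $\{c_1,\dots,c_{N^2}\}$, with $c_i\sim c_j$ ($i\ne j$) iff there is an $\ell$ with $c_i(\ell)=c_j(\ell)$. (Every $LS_m(N)$ has spectrum $\{[(N-1)m]^1,[N-m]^{(N-1)m},[-m]^{(N-1)(N+1-m)}\}$.) The $s$-clique extension of a graph $G$ is obtained by replacing each vertex $x$ by a clique $\tilde X$ on $s$ vertices, where vertices $\tilde x\in\tilde X$, $\tilde y\in\tilde Y$ from cliques of distinct vertices $x,y$ are adjacent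 iff $x\sim y$ in $G$. *)

(* Defs.v *)
From HB Require Import structures.
From mathcomp Require Import all_boot all_order all_algebra all_field.

Set Implicit Arguments.
Unset Strict Implicit.
Unset Printing Implicit Defensive.

Import Order.TTheory GRing.Theory Num.Theory.

Record sgraph := SGraph {
  svertex :> finType;
  adj : rel svertex;
  adj_sym : symmetric adj;
  adj_irrefl : irreflexive adj }.

Section Graphs.

Variable G : sgraph.

Definition neighbours (x : G) : {set G} := [set y | adj x y].

Definition common_nbrs (x y : G) : nat := #|neighbours x :&: neighbours y|.

Definition regular : Prop := exists k, forall x : G, #|neighbours x| = k.

Definition co_edge_regular_with (mu : nat) : Prop :=
  regular /\
  forall x y : G, x != y -> ~~ adj x y -> common_nbrs x y = mu.

Definition co_edge_regular : Prop := exists mu, co_edge_regular_with mu.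

Definition level : nat :=
  size (undup [seq common_nbrs e.1 e.2 | e <- enum {: G * G} & adj e.1 e.2]).

Local Open Scope ring_scope.

Definition adj_mx : 'M[algC]_#|G| :=
  \matrix_(i, j) (adj (enum_val i) (enum_val j))%:R.

Definition eig_mult (a : algC) : nat := mup a (char_poly adj_mx).

Definition has_distinct_eigenvalues (k : nat) : Prop :=
  exists ev : seq algC,
    [/\ uniq ev, size ev = k & forall a, eigenvalue adj_mx a = (a \in ev)].

End Graphs.

(* The spectrum, as a multiset, is represented by its multiplicity function. *)
Definition cospectral (G H : sgraph) : Prop := eig_mult G =1 eig_mult H.

Section CliqueExtension.

Variables (s : nat) (G : sgraph).

Definition clique_ext_rel : rel (G * 'I_s) :=
  fun u v => if u.1 == v.1 then u.2 != v.2 else adj u.1 v.1.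

Lemma clique_ext_sym : symmetric clique_ext_rel.
Proof.
by move=> u v; rewrite /clique_ext_rel eq_sym [u.2 == _]eq_sym adj_sym.
Qed.

Lemma clique_ext_irrefl : irreflexive clique_ext_rel.
Proof. by move=> u; rewrite /clique_ext_rel !eqxx. Qed.

Definition clique_ext : sgraph := SGraph clique_ext_sym clique_ext_irrefl.

End CliqueExtension.

(* The symbols 1..N are represented by 'I_N. *)
Definition orthogonal_array (N m : nat) (A : 'M['I_N]_(m, N ^ 2)) : Prop :=
  forall i j : 'I_m, i != j -> injective (fun l => (A i l, A j l)).

Section LatinSquareGraph.

Variables (N m : nat) (A : 'M['I_N]_(m, N ^ 2)).

(* Vertices are the column indices; the columns of an orthogonal array with at
   least two rows are pairwise distinct, so this is the graph on its columns. *)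
Definition latin_rel : rel 'I_(N ^ 2) :=
  fun c d => (c != d) && [exists l : 'I_m, A l c == A l d].

Lemma latin_sym : symmetric latin_rel.
Proof.
move=> c d; rewrite /latin_rel eq_sym; congr (_ && _).
by apply: eq_existsb => l; rewrite eq_sym.
Qed.

Lemma latin_irrefl : irreflexive latin_rel.
Proof. by move=> c; rewrite /latin_rel eqxx. Qed.

Definition latin_square_graph : sgraph := SGraph latin_sym latin_irrefl.

End LatinSquareGraph.

Definition prime_power (q : nat) : Prop :=
  exists p k : nat, [/\ prime p, 0 < k & q = p ^ k].

(* Main.v *)
(** Replace every point b of an orthogonal array OA(n, q+1) by a block of s q^2
    vertices carrying q+1 maps f_l to q symbols, any two of which take each pair
    of symbols exactly s times.  Two vertices of one block are adjacent, and
    (b, u), (c, v) with b <> c are adjacent iff some coordinate l has b_l = c_l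
    and f_l u = f_l v.  With D_l the relation "same l-th symbol" and T the
    matrix that is the excess (number of agreeing f_l) - 1 inside blocks and 0
    elsewhere, A + I = sum_l D_l - T, where D_l D_m = s J, T D_l = s q D_l and
    T^2 = s q T.  The s-clique extension of LS_(q+1)(q n) has the same form with
    T = q (I (x) J_s), and these relations determine the spectrum; they also
    give A^2 as a combination of A, T, J and I, so the graph is co-edge-regular
    and lambda(x, y) is affine in T(x, y).  As q divides s, the f_l can be
    pairwise independent functionals on F_q^3 that span the whole dual; then T
    takes the values -1, 0 and q - 1 on adjacent pairs of a block. *)

Require Import Defs.
From mathcomp Require Import all_boot all_order all_algebra all_field.
From mathcomp Require Import ring.

Set Implicit Arguments.
Unset Strict Implicit.
Unset Printing Implicit Defensive.

Import Order.TTheory GRing.Theory Num.Theory.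
Local Open Scope ring_scope.

Lemma char_poly_conj (R : comUnitRingType) n (B A : 'M[R]_n) :
  B \in unitmx -> char_poly (invmx B *m A *m B) = char_poly A.
Proof.
move=> uB; rewrite /char_poly /char_poly_mx.
have -> : 'X%:M - map_mx polyC (invmx B *m A *m B)
   = map_mx polyC (invmx B) *m ('X%:M - map_mx polyC A) *m map_mx polyC B.
  rewrite !map_mxM mulmxBr mulmxBl [_ *m 'X%:M]scalar_mxC -(mulmxA 'X%:M) -(map_mxM _ (invmx B) B).
  by rewrite mulVmx // map_mx1 mulmx1.
rewrite !det_mulmx mulrC mulrA -det_mulmx -map_mxM mulmxV // map_mx1 det1.
by rewrite mul1r.
Qed.

Lemma mup_prod_XsubC (F : fieldType) (I : Type) (r : seq I) (d : I -> F) (a : F) :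
  mup a (\prod_(i <- r) ('X - (d i)%:P)) = (\sum_(i <- r) (d i == a))%N.
Proof.
elim: r => [|i r IH].
  by rewrite !big_nil mupNroot // rootC oner_eq0.
rewrite !big_cons mupM ?monic_neq0 ?monic_prod_XsubC ?monicXsubC //.
by rewrite IH -['X - _]expr1 mup_XsubCX eq_sym; case: eqP.
Qed.

Section SpectralMultiplicity.

Variables (F : fieldType) (k : nat).
Variables (theta : 'I_k -> F).
Hypothesis theta_inj : injective theta.

Lemma horner_mx_resolution n (E : 'I_k -> 'M[F]_n.+1) (p : {poly F}) :
  (forall i j, E i *m E j = if i == j then E i else 0) ->
  \sum_i E i = 1 ->
  horner_mx (\sum_i theta i *: E i) p = \sum_i p.[theta i] *: E i.
Proof.
move=> EE E1; elim/poly_ind: p => [|p c IH].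
  by rewrite rmorph0 big1 // => i _; rewrite horner0 scale0r.
rewrite rmorphD rmorphM /= IH horner_mx_X horner_mx_C.
rewrite -scalemx1 -[1%:M]/(1 : 'M[F]_n.+1) -E1 scaler_sumr mulr_suml -big_split.
apply: eq_bigr => i _ /=; rewrite mulr_sumr (bigD1 i) //= big1 => [|j ji].
  rewrite addr0 -scalerAl -scalerAr -[E i * E i]/(E i *m E i) EE eqxx scalerA.
  by rewrite -scalerDl !hornerE.
by rewrite -scalerAl -scalerAr -[E i * E j]/(E i *m E j) EE eq_sym (negPf ji) !scaler0.
Qed.

Definition lagrange (i : 'I_k) : {poly F} :=
  \prod_(j | j != i) ((theta i - theta j)^-1 *: ('X - (theta j)%:P)).

Lemma lagrangeE i j : (lagrange i).[theta j] = (j == i)%:R.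
Proof.
rewrite horner_prod; have [->|ji] := eqVneq j i.
  rewrite big1 // => l li; rewrite !hornerE mulVf // subr_eq0.
  by rewrite (inj_eq theta_inj) eq_sym.
by rewrite (bigD1 j) //= !hornerE subrr mulr0 mul0r.
Qed.

Lemma mup_char_poly_resolution n (E : 'I_k -> 'M[F]_n) (a : F) :
  (forall i j, E i *m E j = if i == j then E i else 0) ->
  \sum_i E i = 1%:M ->
  (mup a (char_poly (\sum_i theta i *: E i)))%:R
    = \sum_(i | theta i == a) \tr (E i).
Proof.
case: n E => [|n] E EE E1.
  rewrite /char_poly det_mx00 mupNroot ?rootC ?oner_eq0 // big1 // => i _.
  by rewrite /mxtrace big_ord0.
set M := \sum_i _.
have hM := horner_mx_resolution _ EE E1; rewrite -/M in hM.
pose rs := [seq theta i | i : 'I_k].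
have urs : uniq rs by rewrite map_inj_uniq ?enum_uniq.
have annM : horner_mx M (\prod_(x <- rs) ('X - x%:P)) = 0.
  rewrite hM big1 // => i _; rewrite horner_prod (bigD1_seq (theta i)) //=.
    by rewrite !hornerE subrr mul0r scale0r.
  by rewrite map_f ?mem_enum.
have [P uP /(similar_diagLR uP) [D MD]] : diagonalizable M.
  by apply/diagonalizableP; exists rs => //; apply: mxminpoly_min.
have {}MD : M = invmx P *m diag_mx D *m P by rewrite MD conjumx ?unitmx_inv // invmxK.
have trM p : \tr (horner_mx M p) = \sum_j p.[D 0 j].
  rewrite MD horner_mx_uconjC // mxtrace_mulC mulmxA mulmxV // mul1mx.
  rewrite horner_mx_diag mxtrace_diag; apply: eq_bigr => j _.
  by rewrite mxE.
have Dth j : exists i, D 0 j == theta i.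
  have: horner_mx M (\prod_(x <- rs) ('X - x%:P)) = 0 := annM.
  rewrite MD horner_mx_uconjC // => /(congr1 (fun A => P *m A *m invmx P)).
  rewrite !mulmxA mulmxV // mul1mx mulmxK // mulmx0 mul0mx horner_mx_diag.
  move/matrixP/(_ j j); rewrite !mxE eqxx mulr1n => /eqP.
  rewrite -/(root _ _) root_prod_XsubC => /mapP [i _ ->]; by exists i.
have -> : (mup a (char_poly M))%:R = \sum_j ((D 0 j == a)%:R : F).
  rewrite MD char_poly_conj // char_poly_trig ?diag_mx_is_trig //.
  under eq_bigr do rewrite mxE eqxx mulr1n.
  by rewrite mup_prod_XsubC natr_sum.
have trE i : \tr (E i) = \sum_j (D 0 j == theta i)%:R.
  have -> : E i = horner_mx M (lagrange i).
    rewrite hM (bigD1 i) //= big1 => [|j ji]; last by rewrite lagrangeE (negPf ji) scale0r.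
    by rewrite lagrangeE eqxx scale1r addr0.
  rewrite trM; apply: eq_bigr => j _.
  by have [l /eqP ->] := Dth j; rewrite lagrangeE (inj_eq theta_inj).
rewrite (eq_bigr _ (fun i _ => trE i)) exchange_big /=; apply: eq_bigr => j _.
have [l /eqP ->] := Dth j.
have [<-|la] := eqVneq.
  rewrite (bigD1 l) //= eqxx big1 ?addr0 // => i /andP [_ il].
  by rewrite (inj_eq theta_inj) eq_sym (negPf il).
rewrite big1 // => i /eqP ia; rewrite (inj_eq theta_inj).
by case: eqP => // li; rewrite -ia li eqxx in la.
Qed.

End SpectralMultiplicity.

Lemma sum_nat_of_bool (R : pzSemiRingType) (T : finType) (P : pred T) :
  \sum_z (P z)%:R = (#|[set x | P x]|)%:R :> R.
Proof.
rewrite -sum1_card natr_sum big_mkcond [RHS]big_mkcond /=.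
by apply: eq_bigr => z _; rewrite inE; case: (P z).
Qed.

Lemma card_symbol (V H : finType) (q s : nat) (h : 'I_q.+1 -> V -> H) :
  (0 < q)%N ->
  (forall l m a b, l != m -> #|[set x | (h l x == a) && (h m x == b)]| = s) ->
  forall l a, #|[set x | h l x == a]| = (s * #|H|)%N.
Proof.
move=> q_gt0 card2 l a.
have [m lm] : exists m, l != m.
  by case: q q_gt0 h card2 l => // q' _ _ _ l; exists (lift l ord0); rewrite neq_lift.
rewrite -sum1_card (partition_big (h m) predT) //=.
rewrite (eq_bigr (fun=> s)) => [|b _]; first by rewrite sum_nat_const mulnC.
rewrite -(card2 l m a b lm) -sum1_card; apply: eq_bigl => x.
by rewrite !inE.
Qed.

Lemma sum_over_symbols (R : pzRingType) (V H : finType) (h : V -> H)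
    (F : V -> R) (c : R) (b : H) :
  (forall a, \sum_z F z * (h z == a)%:R = c * (b == a)%:R) -> \sum_z F z = c.
Proof.
move=> Fh; have -> : \sum_z F z = \sum_a \sum_z F z * (h z == a)%:R.
  rewrite exchange_big /=; apply: eq_bigr => z _; rewrite -mulr_sumr.
  rewrite (bigD1 (h z)) //= eqxx big1 ?addr0 ?mulr1 // => a az.
  by rewrite eq_sym (negPf az).
rewrite (eq_bigr _ (fun a _ => Fh a)) -mulr_sumr.
rewrite (bigD1 b) //= eqxx big1 ?addr0 ?mulr1 // => a az.
by rewrite eq_sym (negPf az).
Qed.

Record array_model (G : sgraph) (H : finType) (q s : nat)
    (h : 'I_q.+1 -> G -> H) (t : G -> G -> algC) : Prop := ArrayModel {
  model_card2 : forall l m a b, l != m ->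
    #|[set x | (h l x == a) && (h m x == b)]| = s;
  model_sym : forall x y, t x y = t y x;
  model_line : forall l x a,
    \sum_z t x z * (h l z == a)%:R = (s * q)%:R * (h l x == a)%:R;
  model_sqr : forall x y, \sum_z t x z * t z y = (s * q)%:R * t x y;
  model_diag : forall x, t x x = q%:R;
  model_adj : forall x y,
    (x == y)%:R + (adj x y)%:R = \sum_l (h l x == h l y)%:R - t x y }.

Definition model_eigenvalue (q s N : nat) (i : 'I_4) : algC :=
  (nth 0%N [:: s * N * q.+1; s * N; 0; s * q]%N i)%:R - (s * q + 1)%:R.

Definition model_multiplicity (q s N : nat) (i : 'I_4) : algC :=
  nth 0 [:: 1; q.+1%:R * (N%:R - 1); (N%:R - 1) * (N%:R - q%:R);
            (s%:R - 1) * N%:R ^+ 2] i.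

Lemma model_eigenvalue_inj q s N : (0 < q)%N -> (0 < s)%N -> (q < N)%N ->
  injective (model_eigenvalue q s N).
Proof.
move=> q_gt0 s_gt0 qN i j /addIr/eqP; rewrite eqr_nat nth_uniq //=.
  by move/eqP/val_inj.
have N_gt0 : (0 < N)%N by apply: leq_trans qN.
have sN_gt0 : (0 < s * N)%N by rewrite muln_gt0 s_gt0.
rewrite !inE !negb_or andbT /= -!lt0n !neq_ltn -!mulnA.
have NqN : (N < N * q.+1)%N by rewrite ltn_Pmulr.
rewrite !ltn_mul2l !muln_gt0 s_gt0 q_gt0 N_gt0 qN NqN (ltn_trans qN NqN) /=.
by rewrite !orbT.
Qed.

Lemma model_multiplicity_neq0 q s N i : (0 < q)%N -> (1 < s)%N -> (q < N)%N ->
  model_multiplicity q s N i != 0.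
Proof.
move=> q_gt0 s_gt1 qN; have N_gt1 : (1 < N)%N by apply: leq_ltn_trans qN.
case: i => [[|[|[|[|//]]]] ?]; rewrite /model_multiplicity /=.
- by rewrite oner_eq0.
- by rewrite mulf_neq0 ?pnatr_eq0 // subr_eq0 pnatr_eq1 gtn_eqF.
- by rewrite mulf_neq0 ?subr_eq0 ?pnatr_eq1 ?eqr_nat ?gtn_eqF.
by rewrite mulf_neq0 ?expf_neq0 ?subr_eq0 ?pnatr_eq1 ?pnatr_eq0 ?gtn_eqF // ltnW.
Qed.

Section ArrayModel.

Variables (G : sgraph) (H : finType) (q s : nat).
Variables (h : 'I_q.+1 -> G -> H) (t : G -> G -> algC).
Hypothesis model : array_model s h t.
Hypotheses (q_gt0 : (0 < q)%N) (s_gt0 : (0 < s)%N).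
Local Notation N := #|H|.
Hypothesis N_gt0 : (0 < N)%N.

Definition kernel_mx (f : G -> G -> algC) : 'M[algC]_#|G| :=
  \matrix_(i, j) f (enum_val i) (enum_val j).

Lemma kernel_mxM f g :
  kernel_mx f *m kernel_mx g = kernel_mx (fun x y => \sum_z f x z * g z y).
Proof.
apply/matrixP => i j; rewrite !mxE [RHS](reindex _ (onW_bij _ (enum_val_bij G))) /=.
by apply: eq_bigr => l _; rewrite !mxE.
Qed.

Lemma kernel_mx_tr f : \tr (kernel_mx f) = \sum_x f x x.
Proof.
rewrite /mxtrace [RHS](reindex _ (onW_bij _ (enum_val_bij G))) /=.
by apply: eq_bigr => l _; rewrite !mxE.
Qed.

Let J : 'M[algC]_#|G| := const_mx 1.
Let S := kernel_mx (fun x y => \sum_l (h l x == h l y)%:R).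
Let T := kernel_mx t.
Let D l := kernel_mx (fun x y => (h l x == h l y)%:R).

Let SE : S = \sum_l D l.
Proof. by apply/matrixP => i j; rewrite summxE !mxE; apply: eq_bigr => l _; rewrite mxE. Qed.

Let JE : J = kernel_mx (fun _ _ => 1).
Proof. by apply/matrixP => i j; rewrite !mxE. Qed.

Let model_card1 l a : #|[set x | h l x == a]| = (s * N)%N.
Proof. exact: card_symbol q_gt0 (model_card2 model) l a. Qed.

Lemma model_card : #|G| = (s * N ^ 2)%N.
Proof.
rewrite -sum1_card (partition_big (h ord0) predT) //=.
rewrite (eq_bigr (fun=> (s * N)%N)) => [|a _].
  by rewrite sum_nat_const mulnC expnS expn1 mulnA.
by rewrite -(model_card1 ord0 a) -sum1_card; apply: eq_bigl => x; rewrite !inE.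
Qed.

Let DD l m : D l *m D m = if l == m then (s * N)%:R *: D l else s%:R *: J.
Proof.
rewrite kernel_mxM; apply/matrixP => i j; rewrite !mxE.
set x := enum_val i; set y := enum_val j.
under eq_bigr do rewrite -natrM mulnb.
rewrite sum_nat_of_bool; have [<-|lm] := eqVneq l m; rewrite !mxE.
  rewrite -natrM; congr _%:R; case: eqP => [xy|xy].
    rewrite muln1 -(model_card1 l (h l x)); apply: eq_card => z.
    by rewrite !inE -xy eq_sym andbb.
  rewrite muln0; apply: eq_card0 => z; rewrite !inE; apply/negP => /andP [/eqP xz /eqP zy].
  by case: xy; rewrite xz.
rewrite mulr1 -(model_card2 model (h l x) (h m y) lm); congr _%:R.
by apply: eq_card => z; rewrite !inE eq_sym.
Qed.

Let SS : S *m S = (s * N)%:R *: S + (s * (q.+1 * q))%:R *: J.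
Proof.
rewrite {1}SE mulmx_suml.
rewrite (eq_bigr (fun l => (s * N)%:R *: D l + (s * q)%:R *: J)) => [|l _].
  rewrite big_split /= -scaler_sumr -SE sumr_const card_ord; congr (_ + _).
  by rewrite -scaler_nat scalerA -natrM mulnCA.
rewrite SE mulmx_sumr (bigD1 l) //= DD eqxx; congr (_ + _).
rewrite (eq_bigr (fun=> s%:R *: J)) => [|m ml]; last by rewrite DD eq_sym (negPf ml).
by rewrite sumr_const cardC1 card_ord /= -scaler_nat scalerA -natrM mulnC.
Qed.

Let DJ l : D l *m J = (s * N)%:R *: J.
Proof.
rewrite JE kernel_mxM; apply/matrixP => i j; rewrite !mxE mulr1.
under eq_bigr do rewrite mulr1.
rewrite sum_nat_of_bool -(model_card1 l (h l (enum_val i))); congr _%:R.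
by apply: eq_card => z; rewrite !inE eq_sym.
Qed.

Let JD l : J *m D l = (s * N)%:R *: J.
Proof.
rewrite JE kernel_mxM; apply/matrixP => i j; rewrite !mxE mulr1.
under eq_bigr do rewrite mul1r.
by rewrite sum_nat_of_bool (model_card1 l).
Qed.

Let SJ : S *m J = (s * N * q.+1)%:R *: J.
Proof.
rewrite SE mulmx_suml (eq_bigr _ (fun l _ => DJ l)) sumr_const card_ord.
by rewrite -scaler_nat scalerA -natrM mulnC.
Qed.

Let JS : J *m S = (s * N * q.+1)%:R *: J.
Proof.
rewrite SE mulmx_sumr (eq_bigr _ (fun l _ => JD l)) sumr_const card_ord.
by rewrite -scaler_nat scalerA -natrM mulnC.
Qed.

Let JJ : J *m J = (s * N ^ 2)%:R *: J.
Proof.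
apply/matrixP => i j; rewrite !mxE -model_card.
under eq_bigr do rewrite !mxE mulr1.
by rewrite sumr_const card_ord mulr1.
Qed.

Let model_row_sum x : \sum_z t x z = (s * q)%:R.
Proof. exact: (sum_over_symbols (model_line model ord0 x)). Qed.

Let TJ : T *m J = (s * q)%:R *: J.
Proof.
rewrite JE kernel_mxM; apply/matrixP => i j; rewrite !mxE mulr1.
by under eq_bigr do rewrite mulr1; rewrite model_row_sum.
Qed.

Let JT : J *m T = (s * q)%:R *: J.
Proof.
rewrite JE kernel_mxM; apply/matrixP => i j; rewrite !mxE mulr1.
by under eq_bigr do rewrite mul1r (model_sym model); rewrite model_row_sum.
Qed.

Let TS : T *m S = (s * q)%:R *: S.
Proof.
rewrite SE mulmx_sumr scaler_sumr; apply: eq_bigr => l _.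
rewrite kernel_mxM; apply/matrixP => i j; rewrite !mxE.
exact: (model_line model).
Qed.

Let ST : S *m T = (s * q)%:R *: S.
Proof.
rewrite SE mulmx_suml scaler_sumr; apply: eq_bigr => l _.
rewrite kernel_mxM; apply/matrixP => i j; rewrite !mxE eq_sym.
rewrite -(model_line model l); apply: eq_bigr => z _.
by rewrite mulrC (model_sym model) eq_sym.
Qed.

Let TT : T *m T = (s * q)%:R *: T.
Proof. by rewrite kernel_mxM; apply/matrixP => i j; rewrite !mxE; exact: (model_sqr model). Qed.

Let adj_mxE : adj_mx G = S - T - 1%:M.
Proof.
apply/matrixP => i j; rewrite !mxE -(model_adj model) (inj_eq enum_val_inj).
by rewrite addrAC subrr add0r.
Qed.

Let adj_mx_sqr : adj_mx G *m adj_mx G =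
  ((s * N)%:R - 2 * (s * q)%:R - 2) *: adj_mx G + ((s * N)%:R - (s * q)%:R) *: T
  + (s * (q.+1 * q))%:R *: J + ((s * N)%:R - 2 * (s * q)%:R - 1) *: 1%:M.
Proof.
rewrite {1 2}adj_mxE !(mulmxBl, mulmxBr) SS ST TS TT !mulmx1 !mul1mx adj_mxE.
by apply/matrixP => i j; rewrite !mxE; ring.
Qed.

Lemma common_nbrsE x y : (common_nbrs x y)%:R =
  ((s * N)%:R - 2 * (s * q)%:R - 2) * (adj x y)%:R
  + ((s * N)%:R - (s * q)%:R) * t x y + (s * (q.+1 * q))%:R
  + ((s * N)%:R - 2 * (s * q)%:R - 1) * (x == y)%:R.
Proof.
have /matrixP/(_ (enum_rank x) (enum_rank y)) := adj_mx_sqr.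
rewrite !mxE !enum_rankK mulr1 (inj_eq enum_rank_inj) => <-.
rewrite [RHS](reindex _ (onW_bij _ (enum_rank_bij G))) /=.
rewrite /common_nbrs -sum1_card natr_sum big_mkcond /=; apply: eq_bigr => z _.
rewrite !mxE !enum_rankK !inE [adj y z]adj_sym.
by case: (adj x z); case: (adj z y); rewrite ?mulr0 ?mulr1.
Qed.

Lemma model_regular : regular G.
Proof.
exists (s * N * q.+1 - s * q - 1)%N => x.
suff e : (#|neighbours x| + s * q + 1)%N = (s * N * q.+1)%N.
  by rewrite -e -subnDA -addnA addnK.
apply/eqP; rewrite -(eqr_nat algC) !natrD.
have : adj_mx G *m J = ((s * N * q.+1)%:R - (s * q)%:R - 1) *: J.
  by rewrite adj_mxE !mulmxBl SJ TJ mul1mx !scalerBl scale1r.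
move/matrixP/(_ (enum_rank x) (enum_rank x)); rewrite !mxE mulr1.
under eq_bigr do rewrite !mxE mulr1 enum_rankK.
rewrite [LHS](reindex _ (onW_bij _ (enum_rank_bij G))) /=.
under eq_bigr do rewrite enum_rankK.
by rewrite sum_nat_of_bool -/(neighbours x) => ->; apply/eqP; ring.
Qed.

Lemma model_co_edge_regular :
  (forall x y, x != y -> ~~ adj x y -> t x y = 0) -> co_edge_regular G.
Proof.
move=> t0; exists (s * (q.+1 * q))%N; split=> [|x y xy nxy]; first exact: model_regular.
apply/eqP; rewrite -(eqr_nat algC) common_nbrsE (negPf xy) (negPf nxy) t0 //.
by rewrite !mulr0 !addr0 add0r.
Qed.

Lemma model_level (e : seq (G * G)) : N != q ->
  all (fun p => adj p.1 p.2) e -> uniq [seq t p.1 p.2 | p <- e] ->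
  (size e <= level G)%N.
Proof.
move=> Nq /allP ae ue; rewrite /level -(size_map (fun p => common_nbrs p.1 p.2) e).
apply: uniq_leq_size => [|_ /mapP [p pe ->]]; last first.
  by rewrite mem_undup; apply/mapP; exists p; rewrite // mem_filter mem_enum /= andbT; exact: ae.
pose c := (s * N)%:R - 2 * (s * q)%:R - 2 + (s * (q.+1 * q))%:R : algC.
pose g (a : algC) := c + ((s * N)%:R - (s * q)%:R) * a.
have g_inj : injective g.
  move=> a b /addrI/mulfI; apply.
  by rewrite subr_eq0 eqr_nat eqn_pmul2l.
apply: (@map_uniq _ _ (fun k : nat => k%:R : algC)); rewrite -map_comp.
rewrite -(map_inj_uniq g_inj) -map_comp in ue.
congr uniq: ue; apply/eq_in_map => p /ae /= ap.
have /negPf p12 : p.1 != p.2 by apply: contraTneq ap => ->; rewrite adj_irrefl.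
by rewrite /= common_nbrsE ap p12 mulr1 mulr0 addr0 [RHS]addrAC.
Qed.


(* An increasing chain of idempotents; the spectral projections of A are the
   successive differences. *)
Let P (i : nat) : 'M[algC]_#|G| :=
  match i with
  | 0 => 0
  | 1 => (s * N ^ 2)%:R^-1 *: J
  | 2 => (s * N)%:R^-1 *: S - (q%:R / (s * N ^ 2)%:R) *: J
  | 3 => (s * q)%:R^-1 *: T
  | _ => 1%:M
  end.

Let P_mul i j : P i *m P j = P (minn i j).
Proof.
have s0 : s%:R != 0 :> algC by rewrite pnatr_eq0 -lt0n.
have q0 : q%:R != 0 :> algC by rewrite pnatr_eq0 -lt0n.
have N0 : N%:R != 0 :> algC by rewrite pnatr_eq0 -lt0n.
case: i => [|[|[|[|i]]]]; case: j => [|[|[|[|j]]]];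
  rewrite /P /minn /= ?mul0mx ?mulmx0 ?mul1mx ?mulmx1 //; try by case: ifP.
all: rewrite ?mulmxBl ?mulmxBr -?scalemxAl -?scalemxAr ?JJ ?JS ?SJ ?SS ?JT ?TJ
    ?ST ?TS ?TT.
all: apply/matrixP => a b; rewrite !mxE ?natrM ?natrX -?natr1 ?natrM; field.
all: by rewrite ?s0 ?q0 ?N0.
Qed.

Lemma model_adj_mx :
  adj_mx G = \sum_i model_eigenvalue q s N i *: (P i.+1 - P i).
Proof.
have s0 : s%:R != 0 :> algC by rewrite pnatr_eq0 -lt0n.
have q0 : q%:R != 0 :> algC by rewrite pnatr_eq0 -lt0n.
have N0 : N%:R != 0 :> algC by rewrite pnatr_eq0 -lt0n.
rewrite !big_ord_recr big_ord0 /= /model_eigenvalue /= adj_mxE.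
apply/matrixP => a b; rewrite !mxE ?natrD ?natrM ?natrX -?natr1 ?natrM.
by field; rewrite ?s0 ?q0 ?N0.
Qed.

Lemma model_trace (i : 'I_4) : \tr (P i.+1 - P i) = model_multiplicity q s N i.
Proof.
have s0 : s%:R != 0 :> algC by rewrite pnatr_eq0 -lt0n.
have q0 : q%:R != 0 :> algC by rewrite pnatr_eq0 -lt0n.
have N0 : N%:R != 0 :> algC by rewrite pnatr_eq0 -lt0n.
have trJ : \tr J = (s * N ^ 2)%:R.
  rewrite JE kernel_mx_tr sumr_const -model_card; congr _%:R; exact: eq_card.
have trS : \tr S = q.+1%:R * (s * N ^ 2)%:R.
  rewrite kernel_mx_tr (eq_bigr (fun=> q.+1%:R)) => [|x _].
    by rewrite sumr_const -model_card mulr_natr; congr (_ *+ _); apply: eq_card.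
  under eq_bigr do rewrite eqxx.
  by rewrite sumr_const card_ord.
have trT : \tr T = q%:R * (s * N ^ 2)%:R.
  rewrite kernel_mx_tr (eq_bigr _ (fun x _ => model_diag model x)).
  by rewrite sumr_const -model_card mulr_natr; congr (_ *+ _); apply: eq_card.
rewrite raddfB /=; case: i => [[|[|[|[|//]]]] ?]; rewrite /P /model_multiplicity /=.
all: rewrite ?raddfB /= ?linearZ /= ?mxtrace0 ?mxtrace1 ?trJ ?trS ?trT ?model_card.
all: rewrite ?natrM ?natrX -?natr1; field.
all: by rewrite ?s0 ?q0 ?N0.
Qed.

Hypothesis q_ltN : (q < N)%N.

Lemma model_eig_mult a : (eig_mult G a)%:R =
  \sum_(i | model_eigenvalue q s N i == a) model_multiplicity q s N i.
Proof.
rewrite /eig_mult model_adj_mx mup_char_poly_resolution.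
- by apply: eq_bigr => i _; exact: model_trace.
- exact: model_eigenvalue_inj.
- move=> i j; rewrite mulmxBl !mulmxBr !P_mul.
  have [<-|] := eqVneq i j.
    rewrite !minnn (minn_idPl (leqnSn i)) (minn_idPr (leqnSn i)).
    by rewrite subrr subr0.
  rewrite neq_ltn => /orP [] ij.
    rewrite (minn_idPl (leqW ij)) (minn_idPl ij) (minn_idPl (leqW (ltnW ij))).
    by rewrite (minn_idPl (ltnW ij)) !subrr.
  rewrite (minn_idPr (leqW ij)) (minn_idPr ij) (minn_idPr (leqW (ltnW ij))).
  by rewrite (minn_idPr (ltnW ij)) subrr.
rewrite !big_ord_recr big_ord0 /=.
by apply/matrixP => a' b; rewrite !mxE; ring.
Qed.

Lemma model_four_eigenvalues : (1 < s)%N -> has_distinct_eigenvalues G 4.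
Proof.
move=> s_gt1; exists [seq model_eigenvalue q s N i | i : 'I_4]; split.
- by rewrite map_inj_uniq ?enum_uniq //; exact: model_eigenvalue_inj.
- by rewrite size_map size_enum_ord.
move=> a; rewrite eigenvalue_root_char -dvdp_XsubCl XsubC_dvd ?monic_neq0 ?char_poly_monic //.
rewrite lt0n -(pnatr_eq0 algC) -/(eig_mult G a) model_eig_mult.
apply/idP/idP => [|/mapP [i _ ->]].
  apply: contraNT => na; rewrite big1 // => i /eqP ia; case/negP: na.
  by rewrite -ia map_f ?mem_enum.
rewrite (bigD1 i) //= big1 ?addr0 ?model_multiplicity_neq0 // => j.
by rewrite (inj_eq (model_eigenvalue_inj _ _ _)) // andbN.
Qed.

End ArrayModel.

Lemma card_fibre (T A C : finType) (f : T -> A) (e : T -> C) (a : A) :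
  injective (fun x => (f x, e x)) -> #|T| = (#|A| * #|C|)%N ->
  #|[set x | f x == a]| = #|C|.
Proof.
move=> fe_inj cT; have [|g fK gK] := inj_card_bij fe_inj.
  by rewrite card_prod cT.
have ginj : injective (fun c => g (a, c)).
  by move=> c d /(can_inj gK) [].
rewrite -cardsT -(card_imset _ ginj); apply: eq_card => x; rewrite inE.
apply/eqP/imsetP => [fx|[c _ ->]]; first by exists (e x); rewrite // -fx fK.
by have [-> _] := gK (a, c).
Qed.

Lemma sum_at_most_one (R : pzSemiRingType) (I : finType) (P : pred I) :
  (forall l m, P l -> P m -> l = m) -> \sum_l (P l)%:R = [exists l, P l]%:R :> R.
Proof.
move=> P1; case: existsP => [[l Pl]|nP].
  rewrite (bigD1 l) //= Pl big1 ?addr0 // => m /negPf ml.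
  by case: (boolP (P m)) => // /P1 /(_ Pl) e; rewrite e eqxx in ml.
by rewrite big1 // => l _; case: (boolP (P l)) => // Pl; case: nP; exists l.
Qed.

Lemma sum_block (R : pzSemiRingType) (B U : finType) (b : B) (F : B * U -> R) :
  \sum_z (b == z.1)%:R * F z = \sum_u F (b, u).
Proof.
transitivity (\sum_c \sum_u (b == c)%:R * F (c, u)).
  by rewrite pair_bigA; apply: eq_bigr => -[].
rewrite (bigD1 b) //= eqxx [X in _ + X]big1 => [|c cb].
  by rewrite addr0; apply: eq_bigr => u _; rewrite mul1r.
by rewrite big1 // => u _; rewrite eq_sym (negPf cb) mul0r.
Qed.

Section Affine.

Variable F : finFieldType.

Definition affine_row (l : nat) (x y z : F) : F :=
  if (l < #|F|)%N then x + nth 0 (enum F) l * y else z.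

Lemma slope_inj l m : (l < #|F|)%N -> (m < #|F|)%N -> l != m ->
  nth 0 (enum F) l - nth 0 (enum F) m != 0.
Proof. by move=> lF mF lm; rewrite subr_eq0 nth_uniq ?enum_uniq -?cardE. Qed.

Lemma slopes_inj l m x y x' y' :
  (l < #|F|)%N -> (m < #|F|)%N -> l != m ->
  x + nth 0 (enum F) l * y = x' + nth 0 (enum F) l * y' ->
  x + nth 0 (enum F) m * y = x' + nth 0 (enum F) m * y' -> (x = x') /\ (y = y').
Proof.
move=> lF mF /(slope_inj lF mF); set c := nth 0 _ l; set d := nth 0 _ m.
move=> cd el em.
have yy : y = y'.
  apply: (mulfI cd); apply: (addrI (x + d * y)).
  have -> : x + d * y + (c - d) * y = x + c * y by ring.
  by rewrite el em; ring.
by split=> //; move: el; rewrite yy => /addIr.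
Qed.

Lemma affine_row_inj l m x y x' y' :
  (l <= #|F|)%N -> (m <= #|F|)%N -> l != m ->
  affine_row l x y y = affine_row l x' y' y' ->
  affine_row m x y y = affine_row m x' y' y' -> (x = x') /\ (y = y').
Proof.
rewrite /affine_row => lF mF lm.
case: ltnP => Fl; case: ltnP => Fm; first exact: slopes_inj.
- by move=> e yy; split=> //; move: e; rewrite yy => /addIr.
- by move=> yy e; split=> //; move: e; rewrite yy => /addIr.
by case/eqP: lm; apply/eqP; rewrite eqn_leq (leq_trans lF Fm) (leq_trans mF Fl).
Qed.

Lemma affine_orthogonal_array m : (m <= #|F|.+1)%N ->
  exists A : 'M['I_#|F|]_(m, #|F| ^ 2), orthogonal_array A.
Proof.
move=> mF; have eF : (#|F| ^ 2 = #|{: F * F}|)%N by rewrite card_prod mulnn.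
pose pt c : F * F := enum_val (cast_ord eF c).
exists (\matrix_(l, c) enum_rank (affine_row l (pt c).1 (pt c).2 (pt c).2)).
move=> l l' ll' c d; rewrite !mxE => -[/enum_rank_inj e /enum_rank_inj e'].
have le (k : 'I_m) : (k <= #|F|)%N by rewrite -ltnS (leq_trans (ltn_ord k)).
have [e1 e2] := affine_row_inj (le l) (le l') ll' e e'.
apply/(@cast_ord_inj _ _ eF)/enum_val_inj; rewrite -/(pt c) -/(pt d).
by rewrite [pt c]surjective_pairing e1 e2 -surjective_pairing.
Qed.

(* q + 1 pairwise independent functionals on F^3 that do not factor through F^2. *)
Definition space_row (k : nat) (l : 'I_#|F|.+1) (u : F * F * F * 'I_k) : F :=
  affine_row l u.1.1.1 u.1.1.2 u.1.2.

Lemma space_row_card2 k l m a b : l != m ->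
  #|[set u : F * F * F * 'I_k | (space_row l u == a) && (space_row m u == b)]|
  = (#|F| * k)%N.
Proof.
move=> lm.
pose f (u : F * F * F * 'I_k) := (space_row l u, space_row m u).
pose e (u : F * F * F * 'I_k) :=
  (if (l < #|F|)%N && (m < #|F|)%N then u.1.2 else u.1.1.2, u.2).
have -> : (#|F| * k = #|{: F * 'I_k}|)%N by rewrite card_prod card_ord.
rewrite -(@card_fibre _ _ _ f e (a, b)); first by apply: eq_card => u; rewrite !inE.
  move=> [[[x y] z] i] [[[x' y'] z'] i'] [].
  rewrite /f /e /space_row /affine_row /=.
  have nlm : ~ ((#|F| <= l)%N /\ (#|F| <= m)%N).
    case=> Fl Fm; case/eqP: lm; apply/val_inj/eqP.
    have le (j : 'I_#|F|.+1) : (j <= #|F|)%N by rewrite -ltnS.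
    by rewrite eqn_leq (leq_trans (le l) Fm) (leq_trans (le m) Fl).
  case: ltnP => Fl; case: ltnP => Fm //= e1 e2 e3 ->.
  - by have [-> ->] := slopes_inj Fl Fm lm e1 e2; rewrite e3.
  - by rewrite e2 e3; move: e1; rewrite e3 => /addIr ->.
  - by rewrite e1 e3; move: e2; rewrite e3 => /addIr ->.
  by case: nlm.
by rewrite !card_prod card_ord; ring.
Qed.

End Affine.

Lemma clique_ext_model q s N (A : 'M['I_N]_(q.+1, N ^ 2)) :
  orthogonal_array A ->
  @array_model (clique_ext s (latin_square_graph A)) 'I_N q s
    (fun l x => A l x.1) (fun x y => (x.1 == y.1)%:R * q%:R).
Proof.
move=> oa; split=> /=.
- move=> l m a b lm.
  rewrite -[RHS]card_ord -(@card_fibre _ _ _ (fun x => (A l x.1, A m x.1)) snd (a, b)).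
  + by apply: eq_card => x; rewrite !inE.
  + move=> [c i] [d j] /= [e1 e2 ->]; congr pair.
    by apply: (oa l m lm); rewrite e1 e2.
  by rewrite !card_prod !card_ord mulnn.
- by move=> x y; rewrite eq_sym.
- move=> l x a; under eq_bigr do rewrite -mulrA.
  rewrite (sum_block x.1 (fun z => q%:R * (A l z.1 == a)%:R)) /=.
  by rewrite sumr_const card_ord natrM -mulrA [RHS]mulr_natl.
- move=> x y; under eq_bigr do rewrite -mulrA.
  rewrite (sum_block x.1 (fun z => q%:R * ((z.1 == y.1)%:R * q%:R))) /=.
  by rewrite sumr_const card_ord natrM -mulrA [RHS]mulr_natl.
- by move=> x; rewrite eqxx mul1r.
move=> [c i] [d j]; rewrite /adj /= /clique_ext_rel /= -pair_eqE /pair_eq /=.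
have [->|cd] := eqVneq c d.
  rewrite (eq_bigr (fun=> 1)) => [|l _]; last by rewrite eqxx.
  rewrite sumr_const card_ord mul1r -natr1 addrAC subrr add0r.
  by case: (i == j); rewrite ?addr0 ?add0r.
rewrite mul0r subr0 add0r /latin_rel cd sum_at_most_one // => l m /eqP el /eqP em.
by apply/eqP; apply: contraNT cd => lm; apply/eqP/(oa l m lm); rewrite el em.
Qed.

Section BlockGraph.

Variables (q s n : nat) (A : 'M['I_n]_(q.+1, n ^ 2)).
Variables (K U : finType) (f : 'I_q.+1 -> U -> K).
Hypothesis oa : orthogonal_array A.
Hypothesis f_card2 : forall l m a b, l != m ->
  #|[set u | (f l u == a) && (f m u == b)]| = s.
Hypotheses (q_gt0 : (0 < q)%N) (K_card : #|K| = q).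

Definition block_symbol (l : 'I_q.+1) (x : 'I_(n ^ 2) * U) : 'I_n * K :=
  (A l x.1, f l x.2).

Definition block_rel : rel ('I_(n ^ 2) * U) :=
  fun x y => (x != y) &&
    ((x.1 == y.1) || [exists l, block_symbol l x == block_symbol l y]).

Lemma block_sym : symmetric block_rel.
Proof.
move=> x y; rewrite /block_rel eq_sym [x.1 == _]eq_sym; congr (_ && (_ || _)).
by apply: eq_existsb => l; rewrite eq_sym.
Qed.

Lemma block_irrefl : irreflexive block_rel.
Proof. by move=> x; rewrite /block_rel eqxx. Qed.

Definition block_graph : sgraph := SGraph block_sym block_irrefl.

Definition excess (u v : U) : algC := \sum_l (f l u == f l v)%:R - 1.

Definition block_excess (x y : 'I_(n ^ 2) * U) : algC :=
  (x.1 == y.1)%:R * excess x.2 y.2.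

Lemma excess_sym u v : excess u v = excess v u.
Proof. by rewrite /excess; congr (_ - _); apply: eq_bigr => l _; rewrite eq_sym. Qed.

Lemma excess_line l u a :
  \sum_v excess u v * (f l v == a)%:R = (s * q)%:R * (f l u == a)%:R.
Proof.
have card1 := card_symbol q_gt0 f_card2; rewrite K_card in card1.
under eq_bigr do rewrite mulrBl mul1r mulr_suml.
rewrite big_split /= sumrN sum_nat_of_bool card1 exchange_big /=.
rewrite (bigD1 l) //= [X in _ + X - _](eq_bigr (fun=> s%:R)) => [|m ml].
  rewrite sumr_const cardC1 card_ord /= -[s%:R *+ q]mulr_natr -natrM addrK.
  under eq_bigr do rewrite -natrM mulnb.
  rewrite sum_nat_of_bool -natrM; congr _%:R; case: eqP => [e|ne].
    rewrite muln1 -(card1 l a); apply: eq_card => v.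
    by rewrite !inE e eq_sym andbb.
  rewrite muln0; apply: eq_card0 => v; rewrite !inE; apply/negP.
  by case/andP => /eqP e1 /eqP e2; case: ne; rewrite e1.
under eq_bigr do rewrite -natrM mulnb.
rewrite sum_nat_of_bool -(f_card2 (f m u) a ml); congr _%:R.
by apply: eq_card => v; rewrite !inE eq_sym.
Qed.

Lemma excess_sqr u v : \sum_w excess u w * excess w v = (s * q)%:R * excess u v.
Proof.
rewrite {2}/excess; under eq_bigr do rewrite mulrBr mulr1 mulr_sumr.
rewrite big_split /= sumrN (sum_over_symbols (excess_line ord0 u)) exchange_big /=.
by rewrite (eq_bigr _ (fun l _ => excess_line l u (f l v))) -mulr_sumr /excess mulrBr mulr1.
Qed.

Lemma block_model : @array_model block_graph ('I_n * K)%type q s block_symbol block_excess.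
Proof.
split=> /=.
- move=> l m [a1 a2] [b1 b2] lm.
  have c1 : #|[set c | (A l c, A m c) == (a1, b1)]| = 1%N.
    rewrite (@card_fibre _ _ _ _ (fun=> tt)) ?card_unit //.
      by move=> c d [e1 e2]; apply: (oa lm); rewrite e1 e2.
    by rewrite !card_prod !card_ord muln1 mulnn.
  have := cardsX [set c | (A l c, A m c) == (a1, b1)]
                 [set u | (f l u == a2) && (f m u == b2)].
  rewrite c1 mul1n f_card2 // => <-; apply: eq_card => x.
  by rewrite !inE /block_symbol !xpair_eqE andbACA.
- by move=> x y; rewrite /block_excess eq_sym excess_sym.
- move=> l x [a1 a2]; rewrite /block_excess; under eq_bigr do rewrite -mulrA.
  rewrite (sum_block x.1 (fun z => excess x.2 z.2 * (block_symbol l z == (a1, a2))%:R)).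
  rewrite /block_symbol /= !xpair_eqE; under eq_bigr do rewrite xpair_eqE -mulnb natrM mulrCA.
  by rewrite -mulr_sumr excess_line mulrCA; congr (_ * _); rewrite -natrM mulnb.
- move=> x y; rewrite /block_excess; under eq_bigr do rewrite -mulrA.
  rewrite (sum_block x.1 (fun z => excess x.2 z.2 * ((z.1 == y.1)%:R * excess z.2 y.2))) /=.
  by under eq_bigr do rewrite mulrCA; rewrite -mulr_sumr excess_sqr mulrCA.
- move=> x; rewrite /block_excess /excess eqxx mul1r.
  rewrite (eq_bigr (fun=> 1)) => [|l _]; last by rewrite eqxx.
  by rewrite sumr_const card_ord -natr1 addrK.
move=> x y; rewrite /adj /= /block_rel /block_excess.
have [e|ne] := eqVneq x.1 y.1.
  rewrite mul1r /excess andbT; under eq_bigr do rewrite /block_symbol e xpair_eqE eqxx.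
  by rewrite subKr; case: (x == y); rewrite ?addr0 ?add0r.
have xy : x != y by apply: contraNneq ne => ->.
rewrite (negPf xy) mul0r subr0 add0r /= sum_at_most_one //.
move=> l m; rewrite /block_symbol !xpair_eqE => /andP [/eqP el _] /andP [/eqP em _].
by apply/eqP; apply: contraNT ne => lm; apply/eqP/(oa lm); rewrite el em.
Qed.

Lemma block_excess_nonadj (x y : block_graph) :
  x != y -> ~~ adj x y -> block_excess x y = 0.
Proof.
move=> xy; rewrite /adj /= /block_rel xy negb_or => /andP [/negPf e _].
by rewrite /block_excess e mul0r.
Qed.

End BlockGraph.

Lemma space_excess (F : finFieldType) k (i : 'I_k) (x z : F) :
  excess (@space_row F k) (0, 0, 0, i) (x, 0, z, i)
    = #|F|%:R * (x == 0)%:R + (z == 0)%:R - 1.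
Proof.
rewrite /excess big_ord_recr /= /space_row /affine_row /= ltnn [0 == z]eq_sym.
rewrite (eq_bigr (fun=> (x == 0)%:R)) => [|l _]; first by rewrite sumr_const card_ord -[_ *+ #|F|]mulr_natl.
by rewrite /= ltn_ord !mulr0 !addr0 eq_sym.
Qed.

Lemma prime_power_field q j : prime_power q -> (0 < j)%N ->
  exists F : finFieldType, #|F| = (q ^ j)%N.
Proof.
case=> p [k [pr_p k_gt0 ->]] j_gt0.
have kj_gt0 : (0 < k * j)%N by rewrite muln_gt0 k_gt0.
by have [F _ cF] := pPrimePowerField pr_p kj_gt0; exists F; rewrite cF expnM.
Qed.

Lemma prime_power_orthogonal_array q j m :
  prime_power q -> (0 < j)%N -> (m <= (q ^ j).+1)%N ->
  exists A : 'M['I_(q ^ j)]_(m, (q ^ j) ^ 2), orthogonal_array A.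
Proof.
move=> hq j_gt0; have [F <-] := prime_power_field hq j_gt0.
exact: affine_orthogonal_array.
Qed.

Lemma array_model_cospectral (G G' : sgraph) (H H' : finType) (q s : nat)
    (h : 'I_q.+1 -> G -> H) (h' : 'I_q.+1 -> G' -> H') t t' :
  array_model s h t -> array_model s h' t' ->
  (0 < q)%N -> (0 < s)%N -> (q < #|H|)%N -> #|H| = #|H'| -> cospectral G G'.
Proof.
move=> M M' q_gt0 s_gt0 qH HH' a; apply/eqP; rewrite -(eqr_nat algC).
have H_gt0 := leq_ltn_trans (leq0n q) qH.
by rewrite (model_eig_mult M) // (model_eig_mult M') -?HH'.
Qed.

Local Close Scope ring_scope.

Theorem theorem1p5 (q s : nat) (hq : prime_power q) (hs : 2 <= s)
    (hqs : q %| s) :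
  forall n0 : nat, exists n : nat,
    [/\ n0 < n,
        exists A : 'M['I_(q * n)]_(q.+1, (q * n) ^ 2), orthogonal_array A
      & exists G : sgraph,
          [/\ co_edge_regular G,
              3 <= level G,
              forall A : 'M['I_(q * n)]_(q.+1, (q * n) ^ 2),
                orthogonal_array A ->
                cospectral G (clique_ext s (latin_square_graph A))
            & has_distinct_eigenvalues G 4]].
Proof.
have q_gt1 : 1 < q by case: hq => p [k [pr_p k_gt0 ->]]; rewrite -(exp1n k) ltn_exp2r ?prime_gt1.
have q_gt0 := ltnW q_gt1; have s_gt0 := ltnW hs.
have [F cF] := prime_power_field hq (isT : 0 < 1); rewrite expn1 in cF.
have oa_exists j : exists A : 'M['I_(q ^ j.+1)]_(q.+1, (q ^ j.+1) ^ 2),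
    orthogonal_array A.
  apply: prime_power_orthogonal_array => //.
  by rewrite ltnS -{1}[q]expn1 leq_exp2l.
move=> n0; exists (q ^ n0.+1); rewrite -expnS; split; last 1 first.
- have [A oa] := oa_exists n0.
  have qN : q < q ^ n0.+2 by rewrite -{1}[q]expn1 ltn_exp2l.
  have cH : #|{: 'I_(q ^ n0.+1) * F}| = q ^ n0.+2.
    by rewrite card_prod card_ord cF -expnSr.
  subst q; have /dvdnP [k sE] := hqs; rewrite mulnC in sE.
  have k_gt0 : 0 < k by move: s_gt0; rewrite sE muln_gt0 => /andP [].
  have f_card2 : forall l m a b, l != m ->
      #|[set u | (@space_row F k l u == a) && (space_row m u == b)]| = s.
    by move=> l m a b lm; rewrite sE; exact: space_row_card2.
  have M := block_model oa f_card2 q_gt0 erefl.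
  have H_gt : #|F| < #|{: 'I_(#|F| ^ n0.+1) * F}| by rewrite cH.
  have b0 : 'I_((#|F| ^ n0.+1) ^ 2) by apply: Ordinal (_ : 0 < _); rewrite !expn_gt0 q_gt0.
  exists (block_graph A (@space_row F k)); split.
  + apply: (model_co_edge_regular M) => //; exact: block_excess_nonadj.
  + pose i0 : 'I_k := Ordinal k_gt0.
    pose pt (x z : F) : block_graph A (@space_row F k) := (b0, (x, 0%R, z, i0)).
    pose e := [seq (pt 0%R 0%R, p) | p <- [:: pt 1%R 1%R; pt 0%R 1%R; pt 1%R 0%R]].
    apply: (@leq_trans (size e)) => //.
    apply: (model_level M) => //; first by rewrite gtn_eqF.
      have F01 : (0%R == 1%R :> F) = false by rewrite eq_sym oner_eq0.
      rewrite /e /= /adj /= /block_rel /= eqxx !andbT.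
      by rewrite !xpair_eqE F01 !andbF.
    rewrite /e /= /block_excess /= eqxx !mul1r !space_excess !eqxx oner_eq0.
    rewrite !mulr0 !mulr1 !addr0 !add0r subrr !inE oppr_eq0 oner_eq0 orbF andbT.
    rewrite eq_sym -subr_eq0 opprK subrK subr_eq0 pnatr_eq0 pnatr_eq1.
    by rewrite !gtn_eqF.
  + move=> A' oa'; apply: (array_model_cospectral M (clique_ext_model s oa')) => //.
    by rewrite cH card_ord.
  by apply: (model_four_eigenvalues M) => //; apply: leq_ltn_trans H_gt.
- by rewrite (ltn_trans (ltnSn n0)) // ltn_expl.
exact: oa_exists.
Qed.
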